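(* Let $\mathcal G_{k,0}^{\mathrm{NS}}\subset Y_{\mathrm{prs}}$ be the selected pressure image at scale $k$ and let $P_{N,k}^{\mathrm{cl}}:Y_{\mathrm{prs}}\to Y_{\mathrm{prs}}$, $N\in\mathbb N$, be finite-rank clean pressure projections (bounded linear). Assume that $\mathcal G_{k,0}^{\mathrm{NS}}$ is precompact in $Y_{\mathrm{prs}}$, that $P_{N,k}^{\mathrm{cl}}g\to g$ in $Y_{\mathrm{prs}}$ as $N\to\infty$ for every $g\in Y_{\mathrm{prs}}$, and that $\sup_N\|P_{N,k}^{\mathrm{cl}}\|_{Y_{\mathrm{prs}}\to Y_{\mathrm{prs}}}<\infty$. Then $$\Delta_{k,\mathrm{proj},N}^{\mathrm{unif}}:=\sup_{g\in\mathcal G_{k,0}^{\mathrm{NS}}}\|(I-P_{N,k}^{\mathrm{cl}})g\|_{Y_{\mathrm{prs}}}\to0\qquad(N\to\infty).$$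
   Context: $B_\rho\subset\mathbb R^3$ is the ball of radius $\rho$ about $0$. $X_{\mathrm{src}}=L^{3/2}((-1,0);L^{3/2}(B_1))^{3\times3}$, $Y_{\mathrm{prs}}=L^{3/2}((-1,0);L^{3/2}(B_{1/2}))$. The clean pressure map is $\mathcal R_{\mathrm{prs}}F=R_iR_j(F_{ij})|_{B_{1/2}}$ with $R_j$ the Riesz transforms on $\mathbb R^3$ in space, sources extended by zero outside $B_1$, repeated indices summed. At scale $k$, $\mathcal F_{k,0}^{\mathrm{NS}}\subset X_{\mathrm{src}}$ is the set of selected clean sources $F^{\mathrm{cl}}_{D_k-\zeta_k}$ attached to the synchronized representatives of the packages $D_k$ in the given Navier--Stokes-generated package class (for the purposes of the statement, a given subset of $X_{\mathrm{src}}$), and $\mathcal G_{k,0}^{\mathrm{NS}}=\{\mathcal R_{\mathrm{prs}}F:F\in\mathcal F_{k,0}^{\mathrm{NS}}\}$. Precompact means having compact closure. *)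

(* Defs.v *)
From HB Require Import structures.
From mathcomp Require Import all_boot all_order all_algebra generic_quotient.
From mathcomp Require Import all_classical all_reals all_analysis.
From mathcomp Require Import measurable_realfun measurable_fun_approximation.

Set Implicit Arguments.
Unset Strict Implicit.
Unset Printing Implicit Defensive.

Import Order.TTheory GRing.Theory Num.Theory.
Import numFieldNormedType.Exports.

Local Open Scope classical_set_scope.
Local Open Scope ring_scope.

Record seminorm (R : realType) (V : lmodType R) := Seminorm {
  snorm :> V -> R ;
  snormD : forall x y, snorm (x + y) <= snorm x + snorm y ;
  snormZ : forall (a : R) x, snorm (a *: x) = `|a| * snorm x }.

(* The normed space V / {x | N x = 0} of a seminormed space (V, N). *)
Section seminorm_quotient.
Context (R : realType) (V : lmodType R) (N : seminorm V).
Local Open Scope quotient_scope.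

Lemma snorm0 : N 0 = 0.
Proof. by rewrite -(scale0r 0) snormZ normr0 mul0r. Qed.

Lemma snormN x : N (- x) = N x.
Proof. by rewrite -scaleN1r snormZ normrN normr1 mul1r. Qed.

Lemma snorm_ge0 x : 0 <= N x.
Proof.
have := snormD N x (- x); rewrite subrr snorm0 snormN -mulr2n.
by rewrite pmulrn_lge0.
Qed.

Definition sn_rel : rel V := fun x y => N (x - y) == 0.

Lemma sn_rel_refl : reflexive sn_rel.
Proof. by move=> x; rewrite /sn_rel subrr snorm0. Qed.

Lemma sn_rel_sym : symmetric sn_rel.
Proof. by move=> x y; rewrite /sn_rel -snormN opprB. Qed.

Lemma sn_rel_trans : transitive sn_rel.
Proof.
move=> y x z /eqP xy /eqP yz; rewrite /sn_rel eq_le snorm_ge0 andbT.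
by rewrite -(subrKA y) (le_trans (snormD _ _ _))// xy yz addr0.
Qed.

Canonical sn_equiv := EquivRel sn_rel sn_rel_refl sn_rel_sym sn_rel_trans.

Definition sn_quot : Type := {eq_quot sn_equiv}.
HB.instance Definition _ := Choice.on sn_quot.
HB.instance Definition _ := EqQuotient.on sn_quot.

Implicit Types x y z : sn_quot.

Definition sn_pi (u : V) : sn_quot := \pi u.

Lemma sn_piK x : sn_pi (repr x) = x.
Proof. exact: reprK. Qed.

Lemma sn_quotW (P : sn_quot -> Prop) : (forall u, P (sn_pi u)) -> forall x, P x.
Proof. by move=> Ppi x; rewrite -[x]sn_piK. Qed.

Lemma sn_quotP (u v : V) : (sn_pi u = sn_pi v) <-> N (u - v) = 0.
Proof.
split=> [/eqP|uv]; first by rewrite eqmodE => /eqP.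
by apply/eqP; rewrite eqmodE; apply/eqP.
Qed.

Lemma repr_piB (u : V) : N (repr (sn_pi u) - u) = 0.
Proof. by apply/sn_quotP; rewrite sn_piK. Qed.

Definition sn_zero : sn_quot := sn_pi 0.
Definition sn_opp x : sn_quot := sn_pi (- repr x).
Definition sn_add x y : sn_quot := sn_pi (repr x + repr y).
Definition sn_scale (a : R) x : sn_quot := sn_pi (a *: repr x).
Definition sn_norm x : R := N (repr x).

Lemma snorm_eq0D (u v : V) : N u = 0 -> N v = 0 -> N (u + v) = 0.
Proof.
move=> u0 v0; apply/eqP; rewrite eq_le snorm_ge0 andbT.
by rewrite (le_trans (snormD _ _ _))// u0 v0 addr0.
Qed.

Lemma pi_opp (u : V) : sn_opp (sn_pi u) = sn_pi (- u).
Proof. by apply/sn_quotP; rewrite -opprD snormN repr_piB. Qed.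

Lemma pi_add (u v : V) : sn_add (sn_pi u) (sn_pi v) = sn_pi (u + v).
Proof.
by apply/sn_quotP; rewrite opprD addrACA; apply: snorm_eq0D; exact: repr_piB.
Qed.

Lemma pi_scale a (u : V) : sn_scale a (sn_pi u) = sn_pi (a *: u).
Proof. by apply/sn_quotP; rewrite -scalerBr snormZ repr_piB mulr0. Qed.

Lemma pi_norm (u : V) : sn_norm (sn_pi u) = N u.
Proof.
apply/eqP; rewrite eq_le /sn_norm; apply/andP; split.
  by rewrite -[leLHS](congr1 N (subrK u _)) (le_trans (snormD _ _ _))//
     repr_piB add0r.
have := repr_piB u; rewrite -snormN opprB => h.
by rewrite -[leLHS](congr1 N (subrK (repr (sn_pi u)) u))
   (le_trans (snormD _ _ _))// h add0r.
Qed.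

Lemma sn_addA : associative sn_add.
Proof. by elim/sn_quotW=> x; elim/sn_quotW=> y; elim/sn_quotW=> z; rewrite !pi_add addrA. Qed.
Lemma sn_addC : commutative sn_add.
Proof. by elim/sn_quotW=> x; elim/sn_quotW=> y; rewrite !pi_add addrC. Qed.
Lemma sn_add0 : left_id sn_zero sn_add.
Proof. by elim/sn_quotW=> x; rewrite !pi_add add0r. Qed.
Lemma sn_addN : left_inverse sn_zero sn_opp sn_add.
Proof. by elim/sn_quotW=> x; rewrite pi_opp pi_add addNr. Qed.

HB.instance Definition _ :=
  GRing.isZmodule.Build sn_quot sn_addA sn_addC sn_add0 sn_addN.

Lemma sn_scaleA (a b : R) x : sn_scale a (sn_scale b x) = sn_scale (a * b) x.
Proof. by elim/sn_quotW: x => x; rewrite !pi_scale scalerA. Qed.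
Lemma sn_scale1 : left_id 1 sn_scale.
Proof. by elim/sn_quotW=> x; rewrite !pi_scale scale1r. Qed.
Lemma sn_scaleDr : right_distributive sn_scale +%R.
Proof.
move=> a; elim/sn_quotW=> x; elim/sn_quotW=> y.
by rewrite /GRing.add/= !(pi_scale, pi_add) scalerDr.
Qed.
Lemma sn_scaleDl x : {morph sn_scale^~ x : a b / a + b}.
Proof.
move=> a b; elim/sn_quotW: x => x.
by rewrite [RHS]/GRing.add/= !(pi_scale, pi_add) scalerDl.
Qed.

HB.instance Definition _ := GRing.Zmodule_isLmodule.Build R sn_quot
  sn_scaleA sn_scale1 sn_scaleDr sn_scaleDl.

Lemma sn_normD x y : sn_norm (x + y) <= sn_norm x + sn_norm y.
Proof.
elim/sn_quotW: x => x; elim/sn_quotW: y => y.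
by rewrite [X in sn_norm X]/GRing.add/= pi_add !pi_norm snormD.
Qed.
Lemma sn_normZ (a : R) x : sn_norm (a *: x) = `|a| * sn_norm x.
Proof.
elim/sn_quotW: x => x.
by rewrite [X in sn_norm X]/GRing.scale/= pi_scale !pi_norm snormZ.
Qed.
Lemma sn_norm0_eq0 x : sn_norm x = 0 -> x = 0.
Proof.
elim/sn_quotW: x => x; rewrite pi_norm => x0.
by apply/sn_quotP; rewrite subr0.
Qed.

HB.instance Definition _ := Lmodule_isNormed.Build R sn_quot
  sn_normD sn_normZ sn_norm0_eq0.

End seminorm_quotient.

Lemma ae_imply2 d (T : measurableType d) (R : realType)
    (mu : {measure set T -> \bar R}) (P Q S : T -> Prop) :
  (forall x, P x -> Q x -> S x) ->
  {ae mu, forall x, P x} -> {ae mu, forall x, Q x} -> {ae mu, forall x, S x}.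
Proof. by move=> PQS; apply: filterS2 => x; exact: PQS. Qed.

Section Lnorm_ae.
Context d (T : measurableType d) (R : realType).
Variables (mu : {measure set T -> \bar R}) (p : R).
Hypothesis p1 : (1 <= p%:E)%E.

Lemma Lnorm_eq0P (f : T -> R) : measurable_fun setT f ->
  fine ('N[mu]_(p%:E)[EFin \o f])%E = 0 ->
  finite_norm mu p%:E f -> {ae mu, forall x, f x = 0}.
Proof.
move=> mf f0 ff.
have /Lnorm_eq0_eq0 : ('N[mu]_(p%:E)[EFin \o f] = 0)%E.
  rewrite -[LHS]fineK ?f0// fin_numElt (lt_le_trans ltNy0) ?Lnorm_ge0//.
have /measurable_EFinP mEf := mf.
move=> /(_ mEf) /(_ (lt_le_trans lte01 p1)).
by apply: filterS => x /(_ I) [].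
Qed.

Lemma Lnorm_ae0 (f : T -> R) : measurable_fun setT f ->
  {ae mu, forall x, f x = 0} -> ('N[mu]_(p%:E)[EFin \o f] = 0)%E.
Proof.
move=> mf f0; have p0 : 0 < p by rewrite (lt_le_trans ltr01)// -lee_fin.
rewrite unlock (ge0_ae_eq_integral _ _ (g := cst 0%E))//.
- by rewrite integral0 poweR0r// invr_neq0// gt_eqF.
- apply: (@measurableT_comp _ _ _ _ _ _ (@poweR R ^~ p)) => //.
    exact: measurable_poweR.
  by apply: measurableT_comp => //; exact/measurable_EFinP.
- by move=> x _; exact: poweR_ge0.
- by apply: filterS f0 => x /= -> _; rewrite normr0 powR0// gt_eqF.
Qed.

End Lnorm_ae.

(* L^p as a normed space; LspaceType has no vector space structure. *)
Section Lp_space.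
Context d (T : measurableType d) (R : realType).
Variables (mu : {measure set T -> \bar R}) (p : R) (p1 : (1 <= p%:E)%E).

Definition Lfun_snorm (f : LfunType mu p1) : R :=
  fine ('N[mu]_(p%:E)[EFin \o f])%E.

Lemma Lfun_snormZ (a : R) (f : LfunType mu p1) :
  Lfun_snorm (a *: f) = `|a| * Lfun_snorm f.
Proof.
apply: EFin_inj; rewrite finite_norm_fine EFinM finite_norm_fine.
by rewrite -LnormZ.
Qed.

Definition Lfun_seminorm : seminorm (LfunType mu p1) :=
  Seminorm (@ler_LnormD _ _ _ mu p%:E p1) Lfun_snormZ.

Definition Lp : Type := sn_quot Lfun_seminorm.
HB.instance Definition _ := NormedModule.on Lp.

Definition Lp_repr (f : Lp) : LfunType mu p1 := repr f.

Lemma Lp_normE (f : Lp) : `|f|%:E = ('N[mu]_(p%:E)[EFin \o Lp_repr f])%E.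
Proof. exact: finite_norm_fine. Qed.

Lemma LpP (f g : Lp) :
  f = g <-> {ae mu, forall x, Lp_repr f x = Lp_repr g x}.
Proof.
split=> [->|fg]; first exact: aeW.
rewrite -[f]sn_piK -[g]sn_piK; apply/sn_quotP => /=.
rewrite /Lfun_snorm Lnorm_ae0//.
by apply: filterS fg => x fgx /=; apply/eqP; rewrite subr_eq0; exact/eqP.
Qed.

End Lp_space.

Section strongly_measurable.
Context d (T : measurableType d) (R : realType) (E : normedModType R).

Definition simple_function (s : T -> E) :=
  finite_set (range s) /\ forall y, measurable (s @^-1` [set y]).

(* Pointwise convergence is required everywhere, not only almost everywhere: as
   the sigma-algebra need not be complete, this is what makes x |-> `|f x|
   measurable; up to a.e. equality the two notions coincide. *)
Definition strongly_measurable (f : T -> E) :=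
  exists2 s : nat -> T -> E, (forall n, simple_function (s n)) &
    forall x, s ^~ x @ \oo --> f x.

Lemma simple_preimage (s : T -> E) (A : set E) :
  simple_function s -> measurable (s @^-1` A).
Proof.
move=> [fs ms].
rewrite (_ : s @^-1` A = \bigcup_(y in range s `&` A) (s @^-1` [set y])).
  by apply: fin_bigcup_measurable => // ; exact: finite_setIl.
apply/seteqP; split => [x Ax|x [y [_ Ay] /= ->]] //.
by exists (s x) => //; split => //; exists x.
Qed.

Lemma simple_function2 (h : E -> E -> E) (s t : T -> E) :
  simple_function s -> simple_function t ->
  simple_function (fun x => h (s x) (t x)).
Proof.
move=> Hs Ht; split; first exact: finite_image11 Hs.1 Ht.1.
move=> y; rewrite (_ : _ @^-1` _ =
  \bigcup_(a in range s) (s @^-1` [set a] `&` t @^-1` [set b | h a b = y])).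
  apply: fin_bigcup_measurable => [|a _]; first exact: Hs.1.
  by apply: measurableI; [exact: Hs.2|exact: simple_preimage].
apply/seteqP; split => [x /= hy|x [a _ [/= -> ]]] //.
by exists (s x); [exists x|].
Qed.

Lemma strongly_measurable0 : strongly_measurable (cst 0).
Proof.
exists (fun=> cst 0) => [_|x]; last exact: cvg_cst.
split; first exact: finite_image_cst.
by move=> y; rewrite preimage_cst; case: ifP.
Qed.

Lemma strongly_measurableZD (a : R) (f g : T -> E) :
  strongly_measurable f -> strongly_measurable g ->
  strongly_measurable (a *: f + g).
Proof.
move=> [s Hs sf] [t Ht tg].
exists (fun n x => a *: s n x + t n x) => [n|x].
  exact: (simple_function2 (fun u v => a *: u + v)).
by apply: cvgD; [apply: cvgZr; exact: sf|exact: tg].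
Qed.

Lemma strongly_measurable_norm (f : T -> E) : strongly_measurable f ->
  measurable_fun setT (fun x => `|f x|).
Proof.
move=> [s Hs sf].
apply: (@measurable_fun_cvg _ _ _ _ (fun n x => `|s n x|)).
  move=> n _ Y mY; rewrite setTI.
  exact: (simple_preimage [set y : E | Y `|y|]).
by move=> x _; apply: cvg_norm; exact: sf.
Qed.

End strongly_measurable.

Section bochner_space.
Context d (T : measurableType d) (R : realType) (E : normedModType R).
Variables (mu : {measure set T -> \bar R}) (p : R) (p1 : (1 <= p%:E)%E).

Definition bochner_pred (f : T -> E) :=
  strongly_measurable f /\ finite_norm mu p%:E (fun x => `|f x|).

Definition bochner_fun of (1 <= p%:E)%E : {pred (T -> E)} :=
  mem [set f | bochner_pred f].

Lemma bochner_norm_Lfun (f : T -> E) : bochner_pred f ->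
  (fun x => `|f x|) \in Lfun mu p%:E.
Proof.
move=> [mf ff]; rewrite inE; apply/andP; split; rewrite inE//=.
exact: strongly_measurable_norm.
Qed.

Lemma Lnorm_normZ (a : R) (f : T -> E) : bochner_pred f ->
  ('N[mu]_(p%:E)[EFin \o (fun x => `|a *: f x|%R)] =
   `|a|%:E * 'N[mu]_(p%:E)[EFin \o (fun x => `|f x|%R)])%E.
Proof.
move=> /bochner_norm_Lfun ff.
have := @LnormZ _ _ _ mu p%:E p1 (Lfun_Sub p1 ff) `|a|.
rewrite normr_id => <-; congr Lnorm; apply/funext => x /=.
by rewrite normrZ.
Qed.

Lemma Lnorm_normD (f g : T -> E) : bochner_pred f -> bochner_pred g ->
  ('N[mu]_(p%:E)[EFin \o (fun x => `|f x + g x|%R)] <=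
   'N[mu]_(p%:E)[EFin \o (fun x => `|f x|%R)] +
   'N[mu]_(p%:E)[EFin \o (fun x => `|g x|%R)])%E.
Proof.
move=> [mf _] [mg _].
have mfg : measurable_fun setT (fun x => `|f x + g x|).
  by apply: strongly_measurable_norm; rewrite -[f](scale1r f);
     exact: strongly_measurableZD.
have mf' := strongly_measurable_norm mf.
have mg' := strongly_measurable_norm mg.
have mp (h : T -> R) : measurable_fun setT h ->
    measurable_fun setT (fun x => (`|(EFin \o h) x| `^ p)%E).
  move=> mh; apply: (measurableT_comp (measurable_poweR _)).
  by apply: measurableT_comp => //; exact/measurable_EFinP.
apply: (@le_trans _ _
  ('N[mu]_(p%:E)[EFin \o ((fun x => `|f x|) \+ (fun x => `|g x|))%R])%E);
  last exact: eminkowski.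
rewrite unlock; apply: gt0_ler_poweR.
- by rewrite invr_ge0 -lee_fin (le_trans _ p1).
- by rewrite in_itv/= leey andbT integral_ge0// => x _; exact: poweR_ge0.
- by rewrite in_itv/= leey andbT integral_ge0// => x _; exact: poweR_ge0.
- apply: ge0_le_integral => //.
  + by move=> x _; exact: poweR_ge0.
  + exact: mp.
  + by apply: mp; exact: measurable_funD.
  + move=> x _; apply: gt0_ler_poweR.
    * by rewrite -lee_fin (le_trans _ p1).
    * by rewrite in_itv/= leey andbT lee_fin normr_ge0.
    * by rewrite in_itv/= leey andbT lee_fin normr_ge0.
    * by rewrite /= lee_fin normr_id (le_trans (ler_normD _ _))// ler_norm.
Qed.

Lemma bochner_submod_closed : submod_closed (bochner_fun p1).
Proof.
split.
  rewrite inE; split; first exact: strongly_measurable0.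
  rewrite /finite_norm (_ : _ \o _ = cst 0%E) ?Lnorm0//.
    by rewrite gt_eqF// (lt_le_trans _ p1).
  by apply/funext => x /=; rewrite normr0.
move=> a f g; rewrite !inE => Hf Hg.
have Haf : bochner_pred (a *: f).
  split; last first.
    rewrite /finite_norm Lnorm_normZ// lte_mul_pinfty ?lee_fin//.
    exact: Hf.2.
  rewrite -[a *: f]addr0; apply: strongly_measurableZD; first exact: Hf.1.
  exact: strongly_measurable0.
split; first by apply: strongly_measurableZD; [exact: Hf.1|exact: Hg.1].
rewrite /finite_norm (le_lt_trans (Lnorm_normD Haf Hg))// lte_add_pinfty//.
  exact: Haf.2.
exact: Hg.2.
Qed.

HB.instance Definition _ := GRing.isSubmodClosed.Build _ _ (bochner_fun p1)
  bochner_submod_closed.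

Record bochnerFun := BochnerFun {
  bochner_val :> T -> E ;
  bochner_valP : bochner_val \in bochner_fun p1 }.

HB.instance Definition _ := [isSub of bochnerFun for bochner_val].
HB.instance Definition _ := [Choice of bochnerFun by <:].
HB.instance Definition _ := [SubChoice_isSubLmodule of bochnerFun by <:].

Definition bochner_snorm (f : bochnerFun) : R :=
  fine ('N[mu]_(p%:E)[EFin \o (fun x => `|f x|%R)])%E.

Lemma bochnerFunP (f : bochnerFun) : bochner_pred f.
Proof. by have := bochner_valP f; rewrite inE. Qed.

Lemma bochner_snormE (f : bochnerFun) :
  (bochner_snorm f)%:E = ('N[mu]_(p%:E)[EFin \o (fun x => `|f x|%R)])%E.
Proof.
rewrite fineK// fin_numElt (lt_le_trans ltNy0) ?Lnorm_ge0//.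
exact: (bochnerFunP f).2.
Qed.

Lemma bochner_snormD (f g : bochnerFun) :
  bochner_snorm (f + g) <= bochner_snorm f + bochner_snorm g.
Proof.
rewrite -lee_fin EFinD !bochner_snormE.
exact: (Lnorm_normD (bochnerFunP f) (bochnerFunP g)).
Qed.

Lemma bochner_snormZ (a : R) (f : bochnerFun) :
  bochner_snorm (a *: f) = `|a| * bochner_snorm f.
Proof.
apply: EFin_inj; rewrite EFinM !bochner_snormE.
exact: (Lnorm_normZ a (bochnerFunP f)).
Qed.

Definition bochner_seminorm : seminorm bochnerFun :=
  Seminorm bochner_snormD bochner_snormZ.

Definition bochner : Type := sn_quot bochner_seminorm.
HB.instance Definition _ := NormedModule.on bochner.

Definition bochner_repr (f : bochner) : bochnerFun := repr f.

Lemma bochner_normE (f : bochner) :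
  `|f|%:E = ('N[mu]_(p%:E)[EFin \o (fun x => `|bochner_repr f x|%R)])%E.
Proof. exact: bochner_snormE. Qed.

Lemma bochnerP (f g : bochner) :
  f = g <-> {ae mu, forall x, bochner_repr f x = bochner_repr g x}.
Proof.
split=> [->|fg]; first exact: aeW.
rewrite -[f]sn_piK -[g]sn_piK; apply/sn_quotP.
apply: EFin_inj; rewrite bochner_snormE.
apply: Lnorm_ae0 => //; first exact: strongly_measurable_norm (bochnerFunP _).1.
apply: filterS fg => x fgx.
by apply/eqP; rewrite normr_eq0 subr_eq0; exact/eqP.
Qed.

End bochner_space.

Section euclidean3.
Context (R : realType).

(* The Borel sigma-algebra carried by lebesgue_measure is the one of
   measurableTypeR R. *)
Definition R3 : Type :=
  (measurableTypeR R * measurableTypeR R * measurableTypeR R)%type.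

Definition leb3 : {measure set R3 -> \bar R} :=
  ((@lebesgue_measure R \x @lebesgue_measure R) \x @lebesgue_measure R)%E.

Definition coord (x : R3) (i : 'I_3) : R := [:: x.1.1; x.1.2; x.2]`_i.

Definition enorm (x : R3) : R := Num.sqrt (\sum_i coord x i ^+ 2).

Definition eball (rho : R) : set R3 := [set x | enorm x < rho].

Lemma measurable_coord i : measurable_fun setT (coord ^~ i).
Proof.
case: i => -[|[|[|//]]] ? ; rewrite /coord/=.
- exact: (measurableT_comp measurable_fst measurable_fst).
- exact: (measurableT_comp measurable_snd measurable_fst).
- exact: measurable_snd.
Qed.

Lemma measurable_enorm : measurable_fun setT enorm.
Proof.
apply: (measurableT_comp (continuous_measurable_fun (@sqrt_continuous R))).
by apply: measurable_sum => i; apply: measurable_funX; exact: measurable_coord.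
Qed.

Lemma measurable_eball rho : measurable (eball rho).
Proof.
rewrite (_ : eball rho = setT `&` enorm @^-1` `]-oo, rho[).
  exact: measurable_enorm.
by rewrite setTI; apply/seteqP; split => x; rewrite /= in_itv.
Qed.

Definition ball_measure (rho : R) : {measure set R3 -> \bar R} :=
  mrestr leb3 (measurable_eball rho).

Definition time_measure : {measure set (measurableTypeR R) -> \bar R} :=
  mrestr (@lebesgue_measure R) (measurable_itv `](-1 : R), 0[).

Definition riesz_kernel (j : 'I_3) (z : R3) : R :=
  (pi ^+ 2)^-1 * (coord z j / enorm z ^+ 4).

(* Principal value; the kernel constant is Gamma(2) / pi^2 = 1 / pi^2. *)
Definition riesz (j : 'I_3) (f : R3 -> R) (x : R3) : R :=
  lim ((\int[leb3]_(y in [set y | (eps < enorm (x - y))%R])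
          (riesz_kernel j (x - y) * f y))%R @[eps --> (0 : R)^'+]).

Lemma p32_ge1 : (1 <= (3 / 2 : R)%:E)%E.
Proof. by rewrite lee_fin ler_pdivlMr// mul1r ler_nat. Qed.

Definition L32_ball (rho : R) : normedModType R := Lp (ball_measure rho) p32_ge1.

Definition L32_time (E : normedModType R) : normedModType R :=
  bochner E time_measure p32_ge1.

(* L^(3/2)((-1, 0); L^(3/2)(B_1))^(3 x 3) and L^(3/2)((-1, 0); L^(3/2)(B_(1/2))). *)
Definition Xsrc : Type := 'M[L32_time (L32_ball 1)]_3.

Definition Yprs : normedModType R := L32_time (L32_ball (1 / 2)).

Definition slice (rho : R) (f : L32_time (L32_ball rho)) (t : R) : R3 -> R :=
  Lp_repr (bochner_repr f t).

Definition source_slice (F : Xsrc) (i j : 'I_3) (t : R) : R3 -> R :=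
  slice (F i j) t \_ (eball 1).

Definition is_pressure (F : Xsrc) (g : Yprs) : Prop :=
  {ae time_measure, forall t, {ae ball_measure (1 / 2), forall x,
    slice g t x =
      \sum_(i < 3) \sum_(j < 3) riesz i (riesz j (source_slice F i j t)) x}}.

Lemma is_pressure_uniq (F : Xsrc) (g h : Yprs) :
  is_pressure F g -> is_pressure F h -> g = h.
Proof.
move=> Fg Fh; apply/bochnerP; apply: (ae_imply2 _ Fg Fh) => t {}Fg {}Fh.
by apply/LpP; apply: (ae_imply2 _ Fg Fh) => x; rewrite /slice => -> ->.
Qed.

(* By the Calderon-Zygmund theorem every F has a pressure g in Yprs, so that the
   default value 0 is never used; g is unique by is_pressure_uniq. *)
Definition Rprs (F : Xsrc) : Yprs := xget 0 [set g | is_pressure F g].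

Definition pressure_image (A : set Xsrc) : set Yprs := [set Rprs F | F in A].

End euclidean3.

Section operators.
Context (R : realType) (V : normedModType R).

Definition opnorm (f : V -> V) : \bar R :=
  ereal_sup [set `|f x|%:E | x in [set x | `|x| <= 1]].

Definition finite_rank (f : V -> V) : Prop :=
  exists (n : nat) (e : 'I_n -> V),
    forall x, exists c : 'I_n -> R, f x = \sum_i c i *: e i.

(* The supremum is taken in [0, +oo], so that it is 0 if A is empty. *)
Definition unif_defect (A : set V) (f : V -> V) : \bar R :=
  ereal_sup (0%E |` [set `|x - f x|%:E | x in A]).

End operators.

(* Main.v *)
(* Since the P_N are equibounded, the error [`|x - P_N x|] is small, for N large,
   on a whole neighbourhood of each point x; by compactness finitely many such
   neighbourhoods cover the closure of the pressure image. *)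
Require Import Defs.
From mathcomp Require Import all_boot all_order all_algebra.
From mathcomp Require Import all_classical all_reals all_analysis.
Import Order.TTheory GRing.Theory Num.Theory.
Import numFieldNormedType.Exports.
Local Open Scope classical_set_scope.
Local Open Scope ring_scope.

(** By homogeneity: a nonzero [x] is rescaled to norm 1, where the supremum defining [opnorm]
    applies; [x = 0] cannot be rescaled and is treated apart. *)
Lemma opnorm_le_bound (R : realType) (V : normedModType R)
    (f : {linear V -> V}) (C : R) (x : V) :
  (opnorm f <= C%:E)%E -> `|f x| <= C * `|x|.
Proof.
move=> fC; have [->|x0] := eqVneq x 0; first by rewrite linear0 !normr0 mulr0.
have nx0 : 0 < `|x| by rewrite normr_gt0.
have : (`|f (`|x|^-1 *: x)|%:E <= C%:E)%E.
  apply: le_trans fC; apply: ereal_sup_ubound; exists (`|x|^-1 *: x) => //=.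
  by rewrite normrZ normfV normr_id mulVf// gt_eqF.
by rewrite linearZ normrZ normfV normr_id lee_fin ler_pdivrMl// mulrC.
Qed.

Lemma unif_defect_ge0 (R : realType) (V : normedModType R) (A : set V)
    (f : V -> V) : (0 <= unif_defect A f)%E.
Proof. by apply: ereal_sup_ubound; left. Qed.

(** The condition [0 <= e] accounts for the value 0 adjoined to the errors, which matters when [A]
    is empty. *)
Lemma unif_defect_le (R : realType) (V : normedModType R) (A : set V)
    (f : V -> V) (e : R) : 0 <= e -> (forall x, A x -> `|x - f x| <= e) ->
  (unif_defect A f <= e%:E)%E.
Proof.
move=> e0 Ae; apply: ge_ereal_sup => _ [->|[x Ax <-]]; rewrite lee_fin//.
exact: Ae.
Qed.

Lemma unif_defect_cvg0 (R : realType) (V : normedModType R) (A : set V)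
    (P : nat -> {linear V -> V}) :
  compact (closure A) -> (forall x, P N x @[N --> \oo] --> x) ->
  (ereal_sup [set opnorm (P N) | N in setT] < +oo)%E ->
  unif_defect A (P N) @[N --> \oo] --> 0%E.
Proof.
move=> cA Pcvg supP.
have [C C0 PC] : exists2 C : R, 0 <= C & forall N x, `|P N x| <= C * `|x|.
  (* [C] is the supremum of the operator norms; the maximum with 0 gives [0 <= C] and rules out -oo,
     so that [fine] loses nothing. *)
  exists (fine (maxe 0%E (ereal_sup [set opnorm (P N) | N in setT]))).
    by rewrite fine_ge0// le_max lexx.
  move=> N x; apply: opnorm_le_bound; rewrite fineK; last first.
    by rewrite ge0_fin_numE ?le_max ?lexx// gt_max supP ltry.
  by rewrite le_max; apply/orP; right; apply: ereal_sup_ubound; exists N.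
have defect_le (e : R) : 0 < e ->
    \forall N \near \oo, (unif_defect A (P N) <= e%:E)%E.
  (* The error at a point near [x] will be bounded by three terms [d], [d] and [C * d], which add up
     to [e]. *)
  move=> e0; pose d := e / (2 + C).
  have C2 : 0 < 2 + C by rewrite ltr_pwDl.
  have d0 : 0 < d by rewrite divr_gt0.
  have : \forall N \near \oo, closure A `<=` [set x | `|x - P N x| <= e].
    (* Compactness in near-covering form: a bound valid for [y] near [x] and [N] large, at each [x]
       of the closure, holds for all large [N] on the whole closure at once. *)
    apply: (compact_near_coveringP (closure A)).1 => // x _.
    have [xd Pd] : nbhs x (ball x d) /\
        \forall N \near \oo, `|x - P N x| < d.
      by split; [exact: nbhsx_ballx|exact: cvgr_dist_lt (Pcvg x) _ d0].
    exists (ball x d, [set N | `|x - P N x| < d]) => // -[y N] [/= xy xN].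
    have yx : `|y - x| <= d.
      by move: xy; rewrite -ball_normE /= distrC => /ltW.
    (* Only the middle term uses the convergence, and only at the fixed centre [x]; the last one is
       controlled by [C] uniformly in [N]. *)
    rewrite (_ : y - P N y = (y - x) + (x - P N x) + P N (x - y)); last first.
      by rewrite linearB !addrA !subrK.
    have -> : e = d + d + C * d.
      by rewrite -mulr2n -mulr_natl -mulrDl /d mulrC divfK// gt_eqF.
    rewrite (le_trans (ler_normD _ _))// lerD//.
      by rewrite (le_trans (ler_normD _ _))// lerD// ltW.
    by rewrite (le_trans (PC _ _))// ler_wpM2l// distrC.
  apply: filterS => N AN; apply: unif_defect_le; first exact: ltW.
  by move=> x Ax; apply: AN; exact: subset_closure.
(* Convergence in the extended reals: the defects are eventually finite (the bound 1 is an arbitrary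
   choice), and their real values tend to 0. *)
apply/fine_cvgP; split.
  apply: filterS (defect_le 1 ltr01) => N N1.
  by rewrite ge0_fin_numE ?unif_defect_ge0// (le_lt_trans N1)// ltry.
apply/cvgrPdist_le => e e0; apply: filterS (defect_le e e0) => N Ne /=.
rewrite sub0r normrN ger0_norm ?fine_ge0 ?unif_defect_ge0//.
by rewrite -[e]/(fine e%:E) fine_le// ge0_fin_numE ?unif_defect_ge0//
  (le_lt_trans Ne)// ltry.
Qed.

Theorem theorem12p2 (R : realType)
    (Fsrc : nat -> set (Xsrc R))
    (P : nat -> nat -> {linear Yprs R -> Yprs R})
    (k : nat)
    (P_bounded : forall N, continuous (P k N))
    (P_finite_rank : forall N, finite_rank (P k N))
    (P_projection : forall N (g : Yprs R), P k N (P k N g) = P k N g)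
    (G_precompact : compact (closure (pressure_image (Fsrc k))))
    (P_cvg : forall g : Yprs R, P k N g @[N --> \oo] --> g)
    (P_unif_bounded : (ereal_sup [set opnorm (P k N) | N in setT] < +oo)%E) :
  unif_defect (pressure_image (Fsrc k)) (P k N) @[N --> \oo] --> 0%E.
Proof. exact: unif_defect_cvg0. Qed.
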